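(* Let $P(\mathbb{R})$ be the set of all Borel probability measures on $\mathbb{R}$ and let $\phi\colon P(\mathbb{R})\to P(\mathbb{R})$ be a surjective map with $d_{Ku}(\phi(\mu),\phi(\nu))=d_{Ku}(\mu,\nu)$ for all $\mu,\nu\in P(\mathbb{R})$. Then there exists a homeomorphism $g\colon\mathbb{R}\to\mathbb{R}$ such that $$\phi(\mu)=\mu\circ g\qquad(\mu\in P(\mathbb{R})).$$ Moreover, every transformation of this form is a surjective isometry of $P(\mathbb{R})$ with respect to the Kuiper distance.
   Context: For Borel probability measures $\mu,\nu$ on $\mathbb{R}$ with distribution functions $f_\mu(t)=\mu((-\infty,t])$, the Kuiper distance is $d_{Ku}(\mu,\nu)=\sup_{t}(f_\mu(t)-f_\nu(t))+\sup_t(f_\nu(t)-f_\mu(t))$, which equals $\sup\{|\mu(I)-\nu(I)|: I\subseteq\mathbb{R}\text{ a non-degenerate interval}\}$. For a homeomorphism $g$ of $\mathbb{R}$, $\mu\circ g$ is the Borel probability measure $(\mu\circ g)(B)=\mu(g(B))$. *)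

(* Defs.v *)
(* R : realType carries the canonical measurable
   structure generated by the intervals ]a,b], i.e. the Borel sigma-algebra. *)
From HB Require Import structures.
From mathcomp Require Import all_boot all_order all_algebra.
From mathcomp Require Import all_classical all_reals all_analysis.
Set Implicit Arguments. Unset Strict Implicit. Unset Printing Implicit Defensive.
Import Order.TTheory GRing.Theory Num.Theory.
Import numFieldNormedType.Exports.
Local Open Scope classical_set_scope.
Local Open Scope ring_scope.

Definition distfun (R : realType) (mu : probability R R) (t : R) : R :=
  fine (mu [set x : R | x <= t]).

Definition dKu (R : realType) (mu nu : probability R R) : R :=
  sup (range (fun t => distfun mu t - distfun nu t)) +
  sup (range (fun t => distfun nu t - distfun mu t)).

Definition meq (R : realType) (mu : probability R R) (m : set R -> \bar R) :=
  forall A : set R, measurable A -> mu A = m A.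

Definition homeo (R : realType) (g : R -> R) :=
  exists h : R -> R, cancel g h /\ cancel h g /\ continuous g /\ continuous h.

Definition comp_homeo (R : realType) (mu : probability R R) (g : R -> R) :
  set R -> \bar R := fun B => mu (g @` B).

Definition surjP (R : realType) (phi : probability R R -> probability R R) :=
  forall nu : probability R R, exists mu, meq (phi mu) nu.

Definition dKu_isometry (R : realType)
  (phi : probability R R -> probability R R) :=
  forall mu nu : probability R R, dKu (phi mu) (phi nu) = dKu mu nu.

(* Main.v *)
Require Import Defs.
From HB Require Import structures.
From mathcomp Require Import all_boot all_order all_algebra.
From mathcomp Require Import all_classical all_reals all_analysis.
From mathcomp Require Import measurable_realfun lra.
Set Implicit Arguments.
Unset Strict Implicit.
Unset Printing Implicit Defensive.
Import Order.TTheory GRing.Theory Num.Theory.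
Import numFieldNormedType.Exports.
Local Open Scope classical_set_scope.
Local Open Scope ring_scope.

(* Write N(mu) for the set of measures at Kuiper distance 1 (the diameter) from
   mu. If mu' <= C mu then N(mu) is contained in N(mu'), and conditioning a
   measure on a set of intermediate mass shows that Dirac measures are exactly
   the mu for which N(mu) included in N(mu') forces mu' = mu. Hence phi permutes
   the Dirac measures, say phi(delta_x) = delta_(h x). Since
   d(mu, delta_x) = 1 - mu{x}, the isometry also transports atoms, so that it
   acts as the pushforward by h on finitely supported measures.
   For four distinct points, d((delta_a + delta_b)/2, (delta_c + delta_d)/2) = 1
   iff {a,b} does not separate {c,d}, so h preserves separation. The Kuiper
   distance is invariant under rotations of the circle R u {oo}, which is why
   finitely supported measures see no more than this cyclic relation; order
   completeness of R (the only gap of the circle is at infinity) upgrades it to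
   betweenness, whence h is a homeomorphism. Empirical measures of quantiles are
   dense, so phi(mu) is the pushforward of mu by h for every mu. *)

(** * Distribution functions of probability measures on the line *)

Section real_probability.
Variable R : realType.
Implicit Types (mu nu : probability R R) (A B : set R) (s t x : R).

Definition pr mu A : R := fine (mu A).

Lemma prE mu A : measurable A -> mu A = (pr mu A)%:E.
Proof. by move=> mA; rewrite /pr fineK// fin_num_measure. Qed.

Lemma pr_ge0 mu A : 0 <= pr mu A.
Proof. by rewrite /pr fine_ge0. Qed.

Lemma pr_setT mu : pr mu setT = 1.
Proof. by rewrite /pr probability_setT. Qed.

Lemma pr_set0 mu : pr mu set0 = 0.
Proof. by rewrite /pr measure0. Qed.

Lemma pr_mono mu A B : measurable A -> measurable B -> A `<=` B ->
  pr mu A <= pr mu B.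
Proof.
by move=> mA mB AB; rewrite -lee_fin -!prE// le_measure// inE.
Qed.

Lemma pr_le1 mu A : measurable A -> pr mu A <= 1.
Proof. by move=> mA; rewrite -(pr_setT mu) pr_mono. Qed.

Lemma prU mu A B : measurable A -> measurable B -> A `&` B = set0 ->
  pr mu (A `|` B) = pr mu A + pr mu B.
Proof.
move=> mA mB AB; apply: EFin_inj.
by rewrite EFinD -!prE ?measureU//; exact: measurableU.
Qed.

Lemma prC mu A : measurable A -> pr mu (~` A) = 1 - pr mu A.
Proof.
move=> mA; apply/eqP; rewrite eq_sym subr_eq -(pr_setT mu) -(setvU A).
by rewrite prU ?setICl//; exact: measurableC.
Qed.

Lemma pr_cvg_bigcup mu (F : (set R)^nat) : (forall n, measurable (F n)) ->
  nondecreasing_seq F -> pr mu \o F @ \oo --> pr mu (\bigcup_n F n).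
Proof.
move=> mF ndF; have mU := bigcupT_measurable _ mF.
apply: fine_cvg; rewrite -prE//; exact: nondecreasing_cvg_mu.
Qed.

Lemma pr_cvg_bigcap mu (F : (set R)^nat) : (forall n, measurable (F n)) ->
  nonincreasing_seq F -> pr mu \o F @ \oo --> pr mu (\bigcap_n F n).
Proof.
move=> mF niF; have mI := bigcapT_measurable mF.
apply: fine_cvg; rewrite -prE//; apply: nonincreasing_cvg_mu => //.
by rewrite -ge0_fin_numE// fin_num_measure.
Qed.

Lemma distfunE mu t : distfun mu t = pr mu `]-oo, t].
Proof. by rewrite /distfun -set_itvNyc. Qed.

Lemma distfun_le1 mu t : distfun mu t <= 1.
Proof. by rewrite distfunE pr_le1. Qed.

Lemma distfun_ge0 mu t : 0 <= distfun mu t.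
Proof. by rewrite distfunE pr_ge0. Qed.

Lemma distfun_nd mu s t : s <= t -> distfun mu s <= distfun mu t.
Proof. by move=> st; rewrite !distfunE pr_mono//; apply: subset_itvl. Qed.

Lemma pr_itvoc mu s t : s <= t -> pr mu `]s, t] = distfun mu t - distfun mu s.
Proof.
move=> st; rewrite !distfunE.
rewrite (_ : [set` `]-oo, t]] = [set` `]-oo, s]] `|` [set` `]s, t]]).
  rewrite prU ?(addrC (pr mu `]-oo, s])) ?addrK//.
  by apply/seteqP; split => x //=; rewrite !in_itv/=; lra.
by apply/seteqP; split => x /=; rewrite !in_itv/=; lra.
Qed.

Lemma distfun_cvgy mu (e : R) : 0 < e -> exists t, 1 - e < distfun mu t.
Proof.
move=> e0; pose F n : set R := [set` `]-oo, n%:R : R]].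
have : pr mu \o F @ \oo --> pr mu (\bigcup_n F n).
  apply: pr_cvg_bigcup => [n|m n mn]; [exact: measurable_itv|apply/subsetPset].
  by apply: subset_itvl; rewrite bnd_simp ler_nat.
have -> : \bigcup_n F n = setT.
  rewrite -subTset => t _; exists (Num.truncn t).+1 => //.
  by rewrite /F/= in_itv/= ltW// truncnS_gt.
rewrite pr_setT => /cvgr_gt /(_ (1 - e)); rewrite ltrBlDr ltrDl => /(_ e0).
by case=> n _ /(_ n (leqnn n)) h; exists n%:R; rewrite distfunE.
Qed.

Lemma distfun_cvgNy mu (e : R) : 0 < e -> exists t, distfun mu t < e.
Proof.
move=> e0; pose F n : set R := [set` `]-oo, - n%:R : R]].
have : pr mu \o F @ \oo --> pr mu (\bigcap_n F n).
  apply: pr_cvg_bigcap => [n|m n mn]; [exact: measurable_itv|apply/subsetPset].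
  by apply: subset_itvl; rewrite bnd_simp lerN2 ler_nat.
have -> : \bigcap_n F n = set0.
  rewrite -subset0 => t /(_ (Num.truncn (- t)).+1 I).
  by rewrite /F/= in_itv/= leNgt ltrNl truncnS_gt.
rewrite pr_set0 => /cvgr_lt /(_ e e0).
by case=> n _ /(_ n (leqnn n)) h; exists (- n%:R); rewrite distfunE.
Qed.

Lemma invSn_anti (m n : nat) : (m <= n)%N -> n.+1%:R^-1 <= m.+1%:R^-1 :> R.
Proof. by move=> mn; rewrite lef_pV2 ?posrE// ler_nat. Qed.

Lemma invSn_lt (e : R) : 0 < e -> exists n : nat, n.+1%:R^-1 < e.
Proof.
move=> e0; exists (Num.truncn e^-1).
by rewrite -[ltRHS]invrK ltf_pV2 ?posrE ?invr_gt0// truncnS_gt.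
Qed.

(** Right continuity in one-sided form: []-oo, x]] is the decreasing intersection of the rays []-oo,
    x + 1/(n+1)]]. *)
Lemma distfun_right mu x (p : R) :
  (forall t, x < t -> p <= distfun mu t) -> p <= distfun mu x.
Proof.
move=> H; rewrite leNgt; apply/negP => xp.
pose F n : set R := [set` `]-oo, x + n.+1%:R^-1]].
have : pr mu \o F @ \oo --> pr mu (\bigcap_n F n).
  apply: pr_cvg_bigcap => [n|m n mn]; [exact: measurable_itv|apply/subsetPset].
  by apply: subset_itvl; rewrite bnd_simp lerD2l invSn_anti.
rewrite -itvNycEbigcap -distfunE => /cvgr_lt /(_ p xp)[n _ /(_ n (leqnn n))].
by apply/negP; rewrite -leNgt /= /F -distfunE; apply: H; rewrite ltrDl.
Qed.

Lemma pr_itvNyo_cvg mu x :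
  (fun n : nat => distfun mu (x - n.+1%:R^-1)) @ \oo --> pr mu `]-oo, x[.
Proof.
pose F n : set R := [set` `]-oo, x - n.+1%:R^-1]].
have : pr mu \o F @ \oo --> pr mu (\bigcup_n F n).
  apply: pr_cvg_bigcup => [n|m n mn]; [exact: measurable_itv|apply/subsetPset].
  by apply: subset_itvl; rewrite bnd_simp lerD2l lerN2 invSn_anti.
have -> : \bigcup_n F n = [set` `]-oo, x[].
  apply/seteqP; split => t.
    case=> n _; rewrite /F/= !in_itv/= => /le_lt_trans; apply.
    by rewrite ltrBlDr ltrDl.
  rewrite /= in_itv/= -subr_gt0 => /invSn_lt[n h]; exists n => //.
  by rewrite /F/= in_itv/= lerBrDr -lerBrDl ltW.
by rewrite (_ : pr mu \o F = fun n : nat => distfun mu (x - n.+1%:R^-1));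
  last by apply/funext => n; rewrite distfunE.
Qed.

(** Closed rays are stable under intersection and generate the Borel sets, and the rays []-oo, n]]
    exhaust the line. *)
Lemma distfun_inj mu nu : distfun mu =1 distfun nu -> meq mu nu.
Proof.
move=> H A mA.
pose G : set (set R) := [set B | exists x, B = `]-oo, x]%classic].
apply: (measure_unique G (fun n => `]-oo, n%:R]%classic)) => //.
- rewrite eqEsubset; split => B.
    apply: smallest_sub; first exact: smallest_sigma_algebra.
    move=> _ [[a b] _ <-]/=.
    rewrite [X in <<s G >> X](_ : _ = `]-oo, b] `\` `]-oo, a])%classic.
      by apply: (@measurableD _ (g_sigma_algebraType G));
        apply: sub_sigma_algebra; eexists.
    apply/seteqP; split => t /=; rewrite !in_itv/=.
      by move=> /andP[at_ ->]; split => //; apply/negP; rewrite -ltNge.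
    by move=> [-> /negP]; rewrite -ltNge andbT.
  apply: smallest_sub; first exact: sigma_algebra_measurable.
  by move=> _ [x ->].
- move=> _ _ [x ->] [y ->]; exists (Num.min x y).
  apply/seteqP; split => t /=; rewrite !in_itv/= le_min; [|by move/andP].
  by case=> -> ->.
- by move=> n; eexists.
- rewrite -subTset => t _; exists (Num.truncn t).+1 => //.
  by rewrite /= in_itv/= ltW// truncnS_gt.
- by move=> _ [x ->]; rewrite [LHS](prE mu)// [RHS](prE nu)// -!distfunE H.
- by move=> n; rewrite [ltLHS](prE mu)// ltry.
Qed.

End real_probability.

(** * The Kuiper distance, conditioning and empirical measures *)

Section kuiper.
Variable R : realType.
Implicit Types (mu nu : probability R R) (A B : set R) (s t x : R).

Definition dev mu nu : R :=
  sup (range (fun t => distfun mu t - distfun nu t)).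

Lemma dKuE mu nu : dKu mu nu = dev mu nu + dev nu mu.
Proof. by []. Qed.

Lemma dev_le mu nu (a : R) :
  (forall t, distfun mu t - distfun nu t <= a) -> dev mu nu <= a.
Proof.
move=> H; apply: ge_sup; first by exists (distfun mu 0 - distfun nu 0), 0.
by move=> _ [t _ <-].
Qed.

Lemma dev_has_ubound mu nu :
  has_ubound (range (fun t => distfun mu t - distfun nu t)).
Proof.
exists 1 => _ [t _ <-].
by have := distfun_le1 mu t; have := distfun_ge0 nu t; lra.
Qed.

Lemma dev_ge mu nu t : distfun mu t - distfun nu t <= dev mu nu.
Proof. by apply: ub_le_sup; [exact: dev_has_ubound|exists t]. Qed.

(** Open rays are increasing unions of closed ones, so the supremum over closed rays controls them
    too. Closed intervals and decreasing maps are handled through this bound. *)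
Lemma dev_ge_left mu nu x :
  pr mu `]-oo, x[ - pr nu `]-oo, x[ <= dev mu nu.
Proof.
have h : (fun n : nat => distfun mu (x - n.+1%:R^-1) -
    distfun nu (x - n.+1%:R^-1)) @ \oo --> pr mu `]-oo, x[ - pr nu `]-oo, x[.
  by apply: cvgB; exact: pr_itvNyo_cvg.
rewrite leNgt; apply/negP => /(cvgr_gt _ h)[n _ /(_ n (leqnn n))].
by apply/negP; rewrite -leNgt; exact: dev_ge.
Qed.

Lemma dev_approx mu nu (e : R) : 0 < e ->
  exists t, dev mu nu - e < distfun mu t - distfun nu t.
Proof.
move=> e0; have [|_ [t _ <-] h] := @sup_adherent R
    (range (fun t => distfun mu t - distfun nu t)) e e0; last by exists t.
by split; [exists (distfun mu 0 - distfun nu 0), 0|exact: dev_has_ubound].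
Qed.

Lemma dev_ge0 mu nu : 0 <= dev mu nu.
Proof.
rewrite leNgt; apply/negP => h.
have [|t] := @distfun_cvgy _ mu (- dev mu nu); first by rewrite oppr_gt0.
by have := dev_ge mu nu t; have := distfun_le1 nu t; lra.
Qed.

Lemma dKu_sym mu nu : dKu mu nu = dKu nu mu.
Proof. by rewrite !dKuE addrC. Qed.

Lemma dKu_refl mu : dKu mu mu = 0.
Proof.
have h : dev mu mu = 0.
  by apply/eqP; rewrite eq_le dev_ge0 andbT; apply: dev_le => t; rewrite subrr.
by rewrite dKuE h addr0.
Qed.

Lemma dKu_triangle mu1 mu2 mu3 : dKu mu1 mu3 <= dKu mu1 mu2 + dKu mu2 mu3.
Proof.
rewrite !dKuE addrACA; rewrite (addrC (dev mu2 mu1)) -addrACA.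
have tri a b c : dev a c <= dev a b + dev b c.
  by apply: dev_le => t; have := dev_ge a b t; have := dev_ge b c t; lra.
have := tri mu1 mu2 mu3; have := tri mu3 mu2 mu1; lra.
Qed.

Lemma dKu_eq0 mu nu : dKu mu nu = 0 -> meq mu nu.
Proof.
rewrite dKuE => h; apply: distfun_inj => t.
have := dev_ge mu nu t; have := dev_ge nu mu t.
have := dev_ge0 mu nu; have := dev_ge0 nu mu; lra.
Qed.

Lemma meq_distfun mu nu : meq mu nu -> distfun mu = distfun nu.
Proof. by move=> H; apply/funext => t; rewrite !distfunE /pr H. Qed.

Lemma meq_pr mu nu A : meq mu nu -> measurable A -> pr mu A = pr nu A.
Proof. by move=> H mA; rewrite /pr H. Qed.

Lemma meq_sym mu nu : meq mu nu -> meq nu mu.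
Proof. by move=> H A mA; rewrite H. Qed.

Lemma meq_trans mu1 mu2 mu3 : meq mu1 mu2 -> meq mu2 mu3 -> meq mu1 mu3.
Proof. by move=> H1 H2 A mA; rewrite H1// H2. Qed.

Lemma eq_dKul mu1 mu2 nu : meq mu1 mu2 -> dKu mu1 nu = dKu mu2 nu.
Proof. by move=> /meq_distfun h; rewrite /dKu h. Qed.

Lemma eq_dKur mu nu1 nu2 : meq nu1 nu2 -> dKu mu nu1 = dKu mu nu2.
Proof. by move=> /meq_distfun h; rewrite /dKu h. Qed.

Lemma meq_dKu mu nu : meq mu nu -> dKu mu nu = 0.
Proof. by move=> h; rewrite (eq_dKul _ h) dKu_refl. Qed.

Lemma dKu_ge_itvoc mu nu s t : s <= t ->
  pr mu `]s, t] - pr nu `]s, t] <= dKu mu nu.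
Proof.
move=> st; rewrite !pr_itvoc// dKuE.
have := dev_ge mu nu t; have := dev_ge nu mu s; lra.
Qed.

Lemma pr_itvcc mu s t : s <= t ->
  pr mu `[s, t] = distfun mu t - pr mu `]-oo, s[.
Proof.
move=> st; rewrite distfunE.
rewrite (_ : [set` `]-oo, t]] = [set` `]-oo, s[] `|` [set` `[s, t]]).
  rewrite prU ?(addrC (pr mu `]-oo, s[)) ?addrK//.
  by apply/seteqP; split => x //=; rewrite !in_itv/=; lra.
by apply/seteqP; split => x /=; rewrite !in_itv/=; lra.
Qed.

Lemma dKu_ge_itvcc mu nu s t : s <= t ->
  pr mu `[s, t] - pr nu `[s, t] <= dKu mu nu.
Proof.
move=> st; rewrite !pr_itvcc// dKuE.
have := dev_ge mu nu t; have := dev_ge_left nu mu s; lra.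
Qed.

(** Take a nearly optimal point for each of the two suprema; their order decides which measure has
    the larger mass on the interval between them. *)
Lemma dKu_approx mu nu (e : R) : 0 < e -> exists s t, s <= t /\
  (dKu mu nu - e < pr mu `]s, t] - pr nu `]s, t] \/
   dKu mu nu - e < pr nu `]s, t] - pr mu `]s, t]).
Proof.
move=> e0; have e20 : 0 < e / 2 by lra.
have [t ht] := dev_approx mu nu e20; have [s hs] := dev_approx nu mu e20.
rewrite dKuE; have [st|ts] := leP s t.
  by exists s, t; split => //; left; rewrite !pr_itvoc//; lra.
by exists t, s; split; [exact: ltW|right; rewrite !pr_itvoc ?ltW//; lra].
Qed.

Lemma dKu_le1 mu nu : dKu mu nu <= 1.
Proof.
apply/ler_addgt0Pr => e /(dKu_approx mu nu)[s [t [st h]]].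
have := pr_ge0 mu `]s, t]; have := pr_ge0 nu `]s, t].
have := @pr_le1 _ mu `]s, t] (measurable_itv _).
have := @pr_le1 _ nu `]s, t] (measurable_itv _).
by case: h; lra.
Qed.

(* If []s, t]] carries almost all of one of nu, mu and almost nothing of the
   other, then domination preserves this when mu is replaced by mu'. *)
Lemma dKu1_dominated mu nu mu' (C : R) :
  (forall A, measurable A -> pr mu' A <= C * pr mu A) ->
  dKu nu mu = 1 -> dKu nu mu' = 1.
Proof.
move=> H d1; apply/eqP; rewrite eq_le dKu_le1 leNgt/=; apply/negP => dlt.
have C1 : 1 <= C by have := H _ measurableT; rewrite !pr_setT mulr1.
have C0 : 0 < C by lra.
(* [C * e] is half the supposed gap: the proof loses at most [e <= C * e] on [nu] and [C * e] on
   [mu']. *)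
pose e := (1 - dKu nu mu') / 2 / C.
have eC : C * e = (1 - dKu nu mu') / 2.
  by rewrite /e mulrC divfK// gt_eqF.
have e0 : 0 < e by rewrite /e !divr_gt0// subr_gt0.
have eCe : e <= C * e by rewrite ler_peMl// ltW.
have [s [t [st]]] := dKu_approx nu mu e0; rewrite d1.
set I := [set` `]s, t]] => h.
have mI : measurable I by exact: measurable_itv.
have mI' := measurableC mI.
have pr01 m : 0 <= pr m I <= 1 by rewrite pr_ge0 pr_le1.
have := pr01 mu; have := pr01 nu; have := pr01 mu'.
have := dKu_ge_itvoc nu mu' st; have := dKu_ge_itvoc mu' nu st; rewrite -/I.
rewrite (dKu_sym mu' nu); have := H _ mI; have := H _ mI'; rewrite !prC//.
case: h => h.
  have : C * pr mu I <= C * e by rewrite ler_pM2l//; have := pr01 nu; lra.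
  lra.
(* Here [mu] concentrates on [I], so domination is used on the complement. *)
have : C * (1 - pr mu I) <= C * e by rewrite ler_pM2l//; have := pr01 nu; lra.
lra.
Qed.

Lemma pr_dirac x A : pr \d_x A = (x \in A)%:R.
Proof. by rewrite /pr /= /dirac indicE. Qed.

(** The interval [[x, x]] gives the lower bound. For the upper one, [distfun \d_x] jumps from 0 to 1
    at [x], so the two deviations are at most the masses strictly below and strictly above [x]. *)
Lemma dKu_dirac mu x : dKu mu \d_x = 1 - pr mu [set x].
Proof.
apply/eqP; rewrite eq_le; apply/andP; split; last first.
  rewrite dKu_sym; have := dKu_ge_itvcc \d_x mu (lexx x).
  by rewrite set_itv1 pr_dirac mem_set.
have fx : pr mu [set x] = distfun mu x - pr mu `]-oo, x[.
  by rewrite -pr_itvcc// set_itv1.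
have df t : distfun \d_x t = (x <= t)%R%:R.
  by rewrite distfunE pr_dirac; congr (nat_of_bool _)%:R; apply/idP/idP;
     rewrite inE/= in_itv.
rewrite dKuE fx; have : dev mu \d_x <= pr mu `]-oo, x[.
  apply: dev_le => t; rewrite df; have [xt|xt] := leP x t.
    have := distfun_le1 mu t; have := pr_ge0 mu `]-oo, x[; rewrite /=; lra.
  rewrite /= ?mulr0n subr0 distfunE pr_mono// => y /=; rewrite !in_itv/=.
  by move=> /le_lt_trans; exact.
have : dev \d_x mu <= 1 - distfun mu x.
  apply: dev_le => t; rewrite df; have [xt|xt] := leP x t.
    by rewrite lerD2l lerN2 distfun_nd.
  have := distfun_le1 mu x; have := distfun_ge0 mu t; rewrite /=; lra.
lra.
Qed.

(** When [mu A = 0] the normalization falls back to [mu] itself. *)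
Definition cond mu A (mA : measurable A) : probability R R :=
  mnormalize (mrestr mu mA) mu.

Lemma pr_cond mu A (mA : measurable A) B : 0 < pr mu A -> measurable B ->
  pr (cond mu mA) B = pr mu (B `&` A) / pr mu A.
Proof.
move=> A0 mB; have E : mrestr mu mA setT = (pr mu A)%:E.
  by rewrite /mrestr setTI prE.
rewrite /pr /= /mnormalize /= E eqe gt_eqF//= /mrestr (prE mu)//.
exact: measurableI.
Qed.

(** This is the domination required by [dKu1_dominated], with [C = (pr mu A)^-1]. *)
Lemma pr_cond_le mu A (mA : measurable A) B : 0 < pr mu A -> measurable B ->
  pr (cond mu mA) B <= (pr mu A)^-1 * pr mu B.
Proof.
move=> A0 mB; rewrite pr_cond// mulrC ler_pM2l ?invr_gt0// pr_mono//.
exact: measurableI.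
Qed.

(* For n = 0 the normalization falls back to the junk value [\d_0]. *)
Definition empirical (t : nat -> R) (n : nat) : probability R R :=
  mnormalize (msum (fun i => \d_(t i)) n) \d_(0 : R).

Lemma pr_empirical (t : nat -> R) n A :
  pr (empirical t n.+1) A = (\sum_(i < n.+1) (t i \in A)%:R) / n.+1%:R.
Proof.
have E B : msum (fun i => \d_(t i)) n.+1 B =
    (\sum_(i < n.+1) (t i \in B)%:R : R)%:E.
  rewrite /msum -sumEFin; apply: eq_bigr => i _; exact: diracE.
have ET : (\sum_(i < n.+1) (t i \in [set: R])%:R : R) = n.+1%:R.
  rewrite (eq_bigr (fun=> 1)) ?sumr_const ?card_ord// => i _.
  by rewrite in_setT.
by rewrite /pr /= /mnormalize /= !E ET eqe pnatr_eq0 /= E.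
Qed.

End kuiper.

(** * Dirac measures as the rigid measures *)

Section dirac_characterization.
Variable R : realType.
Implicit Types (mu nu : probability R R) (A B : set R) (x y : R).

(* This condition only involves distances equal to 1, so surjective isometries
   preserve it; it singles out the Dirac measures. *)
Definition rigid mu := forall mu',
  (forall nu, dKu nu mu = 1 -> dKu nu mu' = 1) -> meq mu' mu.

Lemma pr1_meq_dirac mu x : pr mu [set x] = 1 -> meq mu \d_x.
Proof.
by move=> h; apply: dKu_eq0; rewrite dKu_dirac h subrr.
Qed.

(** If [mu] had mass off [x], conditioning it there would give a measure at distance 1 from [\d_x],
    hence from [mu]; being dominated by [mu], it would be at distance 1 from itself. *)
Lemma rigid_dirac x : rigid \d_x.
Proof.
move=> mu H; apply: pr1_meq_dirac.
have mx : measurable [set x] by exact: measurable_set1.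
have mxC : measurable (~` [set x]) by exact: measurableC.
apply/eqP; rewrite eq_le pr_le1//= leNgt; apply/negP => xlt.
have p0 : 0 < pr mu (~` [set x]) by rewrite prC// subr_gt0.
have : dKu (cond mu mxC) mu = 1.
  by apply: H; rewrite dKu_dirac pr_cond// setICr pr_set0 mul0r subr0.
move=> /(dKu1_dominated (fun B mB => pr_cond_le mxC p0 mB)).
by rewrite dKu_refl => /eqP; rewrite eq_sym oner_eq0.
Qed.

(** A zero-one law: rigidity identifies [mu] with [cond mu mA], which gives [A] full mass. *)
Lemma rigid_pr01 mu A : rigid mu -> measurable A -> 0 < pr mu A -> pr mu A = 1.
Proof.
move=> rmu mA A0; have h : meq (cond mu mA) mu.
  by apply: rmu => nu; apply: dKu1_dominated => B mB; exact: pr_cond_le.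
by rewrite -(meq_pr h)// pr_cond// setIid divff// gt_eqF.
Qed.

(** By the zero-one law [distfun mu] only takes the values 0 and 1, so all the mass sits at its
    jump, the supremum of its zero set. *)
Lemma rigid_is_dirac mu : rigid mu -> exists x, meq mu \d_x.
Proof.
move=> rmu; pose S := [set t | distfun mu t <= 0].
have S0 t : S t \/ distfun mu t = 1.
  rewrite /S/= distfunE; case: leP => h; [by left|right].
  exact: rigid_pr01.
have [b hb] := @distfun_cvgy _ mu 1 ltr01.
have hS : has_sup S.
  split.
    have [t ht] := @distfun_cvgNy _ mu 1 ltr01; exists t.
    by case: (S0 t) ht => // ->; rewrite ltxx.
  exists b => t; rewrite /S/= => tS; rewrite leNgt; apply/negP => bt.
  have := distfun_nd mu (ltW bt); lra.
exists (sup S); apply: pr1_meq_dirac.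
have F1 : 1 <= distfun mu (sup S).
  apply: distfun_right => t st; case: (S0 t) => [|->//].
  by move=> /(sup_upper_bound hS); rewrite leNgt st.
have F0 : pr mu `]-oo, (sup S)[ <= 0.
  rewrite leNgt; apply/negP => h.
  have [n _ /(_ n (leqnn n))/=] := cvgr_gt _ (@pr_itvNyo_cvg _ mu (sup S)) _ h.
  have [e e0 {h}] : exists2 e : R, 0 < e & sup S - n.+1%:R^-1 = sup S - e.
    by exists n.+1%:R^-1.
  move=> ->; have [u uS ul] := sup_adherent e0 hS.
  by apply/negP; rewrite -leNgt (le_trans (distfun_nd mu (ltW ul))).
rewrite -set_itv1 pr_itvcc//.
have := distfun_le1 mu (sup S); have := pr_ge0 mu `]-oo, (sup S)[; lra.
Qed.

End dirac_characterization.

(** * Action of a surjective isometry on Dirac measures and atoms *)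

Section isometry_on_diracs.
Variables (R : realType) (phi : probability R R -> probability R R).
Hypotheses (sphi : surjP phi) (iphi : dKu_isometry phi).
Implicit Types (mu nu : probability R R) (A B : set R) (x y : R).

Lemma isometry_meq mu nu : meq (phi mu) (phi nu) <-> meq mu nu.
Proof.
split=> h; apply: dKu_eq0; first by rewrite -iphi meq_dKu.
by rewrite iphi meq_dKu.
Qed.

(** Surjectivity pulls the competitor [nu'] back to some [mu']; in the converse below it pulls back
    the test measure. *)
Lemma rigid_isometry mu : rigid mu -> rigid (phi mu).
Proof.
move=> rmu nu' H; have [mu' hmu'] := sphi nu'.
apply: meq_trans (meq_sym hmu') _; apply/isometry_meq/rmu => nu d1.
by rewrite -iphi (eq_dKur _ hmu'); apply: H; rewrite iphi.
Qed.

Lemma rigid_isometry_inv mu : rigid (phi mu) -> rigid mu.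
Proof.
move=> rmu mu' H; apply/isometry_meq/rmu => nu' d1.
have [nu hnu] := sphi nu'.
by rewrite -(eq_dKul _ hnu) iphi; apply: H; rewrite -iphi (eq_dKul _ hnu).
Qed.

Lemma meq_dirac_inj x y : meq (\d_x : probability R R) \d_y -> x = y.
Proof.
move=> /meq_pr /(_ (measurable_set1 x)); rewrite !pr_dirac mem_set//.
case: (boolP (y \in _)) => [|_ /eqP]; first by rewrite inE.
by rewrite oner_eq0.
Qed.

Lemma isometry_dirac : exists h h' : R -> R,
  [/\ cancel h h', cancel h' h & forall x, meq (phi \d_x) \d_(h x)].
Proof.
have /choice[h hP] : forall x, exists y, meq (phi \d_x) \d_y.
  by move=> x; apply: rigid_is_dirac; apply: rigid_isometry; exact: rigid_dirac.
have /choice[h' h'P] : forall y, exists x, meq (phi \d_x) \d_y.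
  move=> y; have [mu hmu] := sphi \d_y.
  (* [phi mu] is [\d_y] only up to [meq], so the rigidity of [\d_y] is transported by hand. *)
  have [x hx] : exists x, meq mu \d_x.
    apply: rigid_is_dirac; apply: rigid_isometry_inv => mu' H.
    apply: meq_trans _ (meq_sym hmu); apply: rigid_dirac => nu d1.
    by apply: H; rewrite (eq_dKur _ hmu).
  by exists x; apply: meq_trans _ hmu; apply/isometry_meq; exact: meq_sym.
exists h, h'; split => // x; apply: meq_dirac_inj.
  by apply/isometry_meq; exact: meq_trans (h'P _) (meq_sym (hP _)).
exact: meq_trans (meq_sym (hP _)) (h'P _).
Qed.

Lemma isometry_atom h : (forall x, meq (phi \d_x) \d_(h x)) ->
  forall mu x, pr (phi mu) [set h x] = pr mu [set x].
Proof.
move=> hP mu x; have := dKu_dirac (phi mu) (h x).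
rewrite -(eq_dKur _ (hP x)) iphi dKu_dirac; lra.
Qed.

End isometry_on_diracs.

(** * Atoms of empirical measures and separation of pairs *)

Section empirical_measures.
Variable R : realType.
Implicit Types (m mu nu : probability R R) (A B : set R) (x y : R).

Lemma sum_atoms_le m (s : seq R) A : uniq s -> measurable A ->
  \sum_(y <- s | y \in A) pr m [set y] <= pr m A.
Proof.
elim: s A => [|y s IH] A /=; first by rewrite big_nil pr_ge0.
move=> /andP[ys us] mA; rewrite big_cons.
have my : measurable [set y] by exact: measurable_set1.
have -> : \sum_(j <- s | j \in A) pr m [set j] =
    \sum_(j <- s | j \in A `\ y) pr m [set j].
  rewrite big_seq_cond [RHS]big_seq_cond; apply: eq_bigl => j.
  case: (boolP (j \in s)) => //= js; rewrite in_setD.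
  rewrite [in RHS](_ : j \in [set y] = false) ?andbT//.
  apply/negbTE; apply: contra ys; rewrite inE => /= <-; exact: js.
have IHA := IH (A `\ y) us (measurableD mA my).
case: ifPn => [yA|_]; last first.
  apply: le_trans IHA _; apply: pr_mono => //; exact: measurableD.
have -> : pr m A = pr m [set y] + pr m (A `\ y).
  rewrite -prU ?setDIK//; last exact: measurableD.
  by rewrite setDUK// => _ ->; rewrite inE in yA.
by rewrite lerD2l.
Qed.

(* Summing over atoms gives empirical <= m on every set, and comparing on
   complements forces equality, as both have mass 1. *)
Lemma meq_empirical m (t : nat -> R) n :
  (forall y, pr (empirical t n.+1) [set y] <= pr m [set y]) ->
  meq m (empirical t n.+1).
Proof.
move=> H; have le A : measurable A -> pr (empirical t n.+1) A <= pr m A.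
  move=> mA; pose s := undup [seq t (nat_of_ord i) | i <- index_enum 'I_n.+1].
  apply: le_trans (sum_atoms_le m (undup_uniq _ : uniq s) mA).
  apply: le_trans (ler_sum _ (fun y _ => H y)).
  rewrite pr_empirical.
  rewrite (eq_bigr _ (fun y _ => pr_empirical t n [set y])).
  (* Sample points may repeat, but [s] lists each value once; after the exchange, index [i]
     contributes only through [y = t i]. *)
  rewrite -mulr_suml ler_pM2r ?invr_gt0// exchange_big/=.
  rewrite le_eqVlt; apply/orP; left; apply/eqP/eq_bigr => i _.
  rewrite big_mkcond (bigD1_seq (t i))/= ?undup_uniq//; last first.
    by rewrite mem_undup map_f// mem_index_enum.
  rewrite big1 ?addr0 => [|y yti]; last first.
    case: ifP => // _; case: (boolP (_ \in _)) => //; rewrite inE/= => e.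
    by rewrite e eqxx in yti.
  by case: ifP => // _; rewrite mem_set.
have e A : measurable A -> pr m A = pr (empirical t n.+1) A.
  move=> mA; apply/eqP; rewrite eq_le le// andbT.
  by have := le _ (measurableC mA); rewrite !prC//; lra.
by move=> A mA; rewrite (prE m)// (prE (empirical t n.+1))// e.
Qed.

Lemma empirical_comp_atom (t : nat -> R) (h : R -> R) n x : injective h ->
  pr (empirical (h \o t) n.+1) [set h x] = pr (empirical t n.+1) [set x].
Proof.
move=> hinj; rewrite !pr_empirical; congr (_ / _); apply: eq_bigr => i _.
congr (nat_of_bool _)%:R; apply/idP/idP; rewrite !inE/=; first exact: hinj.
by move=> ->.
Qed.

(** An empirical measure, so that [isometry_empirical] applies; [a = b] gives a Dirac measure. *)
Definition two_points a b : probability R R :=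
  empirical (fun i => if i is 0%N then a else b) 2.

Lemma pr_two_points a b A :
  pr (two_points a b) A = ((a \in A)%:R + (b \in A)%:R) / 2.
Proof. by rewrite pr_empirical big_ord_recl big_ord1. Qed.

(** For distinct points, this is linking of the pairs [a, b] and [c, d] on the circle formed by the
    line and infinity. *)
Definition separates (a b c d : R) : bool :=
  (Num.min a b < c < Num.max a b) (+) (Num.min a b < d < Num.max a b).

Lemma dKu_two_points_split s t a b c d :
    s <= a <= t -> s <= b <= t -> ~~ (s <= c <= t) -> ~~ (s <= d <= t) ->
  dKu (two_points a b) (two_points c d) = 1.
Proof.
move=> sa sb sc sd; apply/eqP; rewrite eq_le dKu_le1/=.
have st : s <= t by lra.
have mE x : (x \in [set` `[s, t]]) = (s <= x <= t).
  by apply/idP/idP; rewrite inE/= in_itv.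
have := dKu_ge_itvcc (two_points a b) (two_points c d) st.
rewrite !pr_two_points !mE sa sb (negbTE sc) (negbTE sd) /=; lra.
Qed.

Lemma notin_itv_cmp s t x c d :
    ~~ (s < x <= t) -> s < c <= t -> s < d <= t ->
  (c < x) = (d < x) /\ (x < c) = (x < d).
Proof.
rewrite negb_and -leNgt -ltNge => /orP[xs|tx] /andP[sc ct] /andP[sd dt].
  rewrite !(le_lt_trans xs)// !ltNge !ltW//; exact: le_lt_trans xs _.
rewrite (le_lt_trans ct tx) (le_lt_trans dt tx).
by rewrite !ltNge !ltW//; apply: le_lt_trans tx.
Qed.

Lemma dKu_two_points a b c d :
    a != c -> a != d -> b != c -> b != d ->
  dKu (two_points a b) (two_points c d) = 1 <-> ~~ separates a b c d.
Proof.
move=> ac ad bc bd; rewrite /separates; split=> [d1|].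
  (* Two-point masses are multiples of 1/2, so a difference above 1/2 equals 1: the interval holds
     one pair and misses the other. *)
  have e0 : 0 < 1 / 2 :> R by lra.
  have [s [t [st]]] := dKu_approx (two_points a b) (two_points c d) e0.
  have mE x : (x \in [set` `]s, t]]) = (s < x <= t).
    by apply/idP/idP; rewrite inE/= in_itv.
  rewrite d1 !pr_two_points !mE => h.
  have {h} : [&& s < a <= t, s < b <= t, ~~ (s < c <= t) & ~~ (s < d <= t)] ||
      [&& ~~ (s < a <= t), ~~ (s < b <= t), s < c <= t & s < d <= t].
    move: h; case: (s < a <= t); case: (s < b <= t);
    case: (s < c <= t); case: (s < d <= t) => //= h; exfalso; lra.
  move=> /orP[] /and4P[ha hb hc hd].
    have outF u v x : s < u <= t -> s < v <= t -> ~~ (s < x <= t) ->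
        (u < x < v) = false.
      move=> hu hv hx; have [e _] := notin_itv_cmp hx hu hv.
      by apply/negP => /andP[ux]; rewrite ltNge ltW// -e.
    by have [] := ltP a b => _; rewrite !outF.
  have inE u v : ~~ (s < u <= t) -> ~~ (s < v <= t) ->
      (u < c < v) = (u < d < v).
    move=> hu hv; have [_ ->] := notin_itv_cmp hu hc hd.
    by have [-> _] := notin_itv_cmp hv hc hd.
  by have [] := ltP a b => _; rewrite inE// addbb.
(* The witness interval is the hull of [c, d] if both lie between [a] and [b], and the hull of
   [a, b] if neither does. *)
have [cin|cout] := boolP (Num.min a b < c < Num.max a b);
  have [din|dout] := boolP (Num.min a b < d < Num.max a b) => //= _.
  rewrite dKu_sym.
  by apply: (@dKu_two_points_split (Num.min c d) (Num.max c d));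
    move: cin din; have [] := ltP a b; have [] := ltP c d; lra.
by apply: (@dKu_two_points_split (Num.min a b) (Num.max a b));
  move: cout dout; have [] := ltP a b; lra.
Qed.

End empirical_measures.

(** * Action of the isometry on empirical measures *)

Section isometry_on_empirical_measures.
Variables (R : realType) (phi : probability R R -> probability R R).
Hypothesis iphi : dKu_isometry phi.
Variables h h' : R -> R.
Hypotheses (hK : cancel h h') (h'K : cancel h' h).
Hypothesis phih : forall x, meq (phi \d_x) \d_(h x).

Lemma isometry_empirical (t : nat -> R) n :
  meq (phi (empirical t n.+1)) (empirical (h \o t) n.+1).
Proof.
apply: meq_empirical => y.
rewrite -(h'K y) empirical_comp_atom; last exact: can_inj hK.
by rewrite (isometry_atom iphi phih).
Qed.

Lemma isometry_separates a b c d :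
    a != c -> a != d -> b != c -> b != d ->
  separates (h a) (h b) (h c) (h d) = separates a b c d.
Proof.
have hI := inj_eq (can_inj hK).
have h2 u v : meq (phi (two_points u v)) (two_points (h u) (h v)).
  apply: meq_trans (isometry_empirical _ _) _.
  apply: dKu_eq0; rewrite /two_points /=.
  by rewrite (_ : _ \o _ = fun i => if i is 0%N then h u else h v) ?dKu_refl//;
    apply/funext => -[].
move=> ac ad bc bd; apply: negb_inj; apply/idP/idP => H.
  apply/dKu_two_points => //; rewrite -iphi (eq_dKul _ (h2 _ _)).
  by rewrite (eq_dKur _ (h2 _ _)); apply/dKu_two_points => //; rewrite hI.
apply/dKu_two_points; rewrite ?hI//.
rewrite -(eq_dKul _ (h2 _ _)) -(eq_dKur _ (h2 _ _)) iphi.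
exact/dKu_two_points.
Qed.

End isometry_on_empirical_measures.

(** * Bijections of the line that preserve separation *)

Section separation_preserving.
Variable R : realType.
Implicit Types (a b c d x y : R) (h : R -> R).

Lemma separates_lt a b c d : a < b ->
  separates a b c d = (a < c < b) (+) (a < d < b).
Proof. by rewrite /separates; case: ltP. Qed.

Lemma separatesC a b c d : separates a b c d = separates b a c d.
Proof. by rewrite /separates minC maxC. Qed.

Lemma separatesN a b c d :
  separates (- a) (- b) (- c) (- d) = separates a b c d.
Proof.
rewrite /separates -oppr_max -oppr_min !ltrN2.
by rewrite ![in LHS](andbC (_ < Num.max _ _)).
Qed.

Definition preserves_separation h := forall a b c d,
  a != c -> a != d -> b != c -> b != d ->
  separates (h a) (h b) (h c) (h d) = separates a b c d.

Lemma preserves_separation_can h h' : cancel h h' -> cancel h' h ->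
  preserves_separation h -> preserves_separation h'.
Proof.
move=> hK h'K H a b c d ac ad bc bd; have I := inj_eq (can_inj h'K).
by rewrite -[in RHS](h'K a) -(h'K b) -(h'K c) -(h'K d) !hK H// I.
Qed.

(* Otherwise h maps ]a, b[ outside [h a, h b]. By separation, the points of
   ]a, b[ sent below h a precede those sent above h b, and the supremum s of the
   former can belong to neither class, because h s - 1 and h s + 1 have
   preimages on the wrong side of s. *)
Lemma preserves_betweenness_lt h h' : cancel h h' -> cancel h' h ->
    preserves_separation h ->
  forall a b c, a < c < b -> h a < h b -> h a < h c < h b.
Proof.
move=> hK h'K H a b c0 /andP[ac0 c0b] hab; apply: contraT => hc0.
have ab := lt_trans ac0 c0b; have I := inj_eq (can_inj hK).
(* Comparison with the violating point [c0] shows that [h] swaps inside and outside: this is [outI]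
   and [inO]. By surjectivity, [pre] inverts [outI]. *)
have outI e : e != a -> e != b -> ~~ (a < e < b) -> h a < h e < h b.
  move=> ea eb /negbTE he; have := H a b c0 e.
  rewrite !separates_lt// ac0 c0b (negbTE hc0) he /=; apply.
  - by rewrite lt_eqF.
  - by rewrite eq_sym.
  - by rewrite gt_eqF.
  - by rewrite eq_sym.
have inO c : a < c -> c < b -> (h c < h a) || (h b < h c).
  move=> ac cb; have := H a b c0 c.
  rewrite !separates_lt// ac0 c0b (negbTE hc0) ac cb /=.
  rewrite (lt_eqF ac0) (lt_eqF ac) (gt_eqF c0b) (gt_eqF cb).
  move=> /(_ isT isT isT isT) /negbT; rewrite negb_and -!leNgt !le_eqVlt.
  by rewrite !I (gt_eqF ac) (gt_eqF cb).
have pre y : y < h a \/ h b < y -> a < h' y < b.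
  move=> hy; apply: contraT => /outI; rewrite h'K.
  have ya : h' y != a by rewrite -I h'K; case: hy; lra.
  have yb : h' y != b by rewrite -I h'K; case: hy; lra.
  by move=> /(_ ya yb); case: hy; lra.
pose L := [set c | a < c < b /\ h c < h a].
have LU c c' : L c -> c' < b -> a < c' -> h b < h c' -> c < c'.
  move=> [/andP[ac cb] hca] c'b ac' hbc'.
  have hac' := lt_trans hab hbc'; have hcc' := lt_trans hca hac'.
  (* Of [h b] and [h c], only [h b] lies between [h a] and [h c']; since [b] is not between [a] and
     [c'], the point [c] must be. *)
  have := H a c' b c; rewrite (lt_eqF ab) (lt_eqF ac) (lt_eqF c'b).
  rewrite -I (gt_eqF hcc') => /(_ isT isT isT isT).
  rewrite !separates_lt// hab hbc' (ltNge b) (ltW c'b) andbF ac.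
  by rewrite (ltNge (h a)) (ltW hca).
have [u [uL]] : exists u, L u /\ h u < h a.
  exists (h' (h a - 1)); split; last by rewrite h'K; lra.
  by split; [apply: pre; left; lra|rewrite h'K; lra].
have /andP[aw wb] : a < h' (h b + 1) < b by apply: pre; right; lra.
have hbw : h b < h (h' (h b + 1)) by rewrite h'K; lra.
set w := h' _ in aw wb hbw => hua.
have hS : has_sup L by split; [exists u|exists w => v vL; apply/ltW/LU].
pose s := sup L.
have as_ : a < s.
  case: (uL) => /andP[au _] _; apply: lt_le_trans au _.
  exact: sup_upper_bound.
have sb : s < b.
  apply: le_lt_trans (wb); apply: ge_sup; first by exists u.
  by move=> v vL; apply/ltW/LU.
have /orP[hsa|hbs] := inO s as_ sb.
  pose c := h' (h s - 1).
  have hcs : h c < h s by rewrite /c h'K; lra.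
  have /andP[ac cb] : a < c < b by apply: pre; left; lra.
  have cL : L c by split; [rewrite ac|lra].
  have cs : c <= s by exact: sup_upper_bound.
  (* Of [h s] and [h b], only [h s] lies between [h c] and [h a], yet neither [s] nor [b] lies
     between [a] and [c]. The other case mirrors this. *)
  have := H a c s b.
  rewrite (lt_eqF as_) (lt_eqF ab) (lt_eqF cb) -I (lt_eqF hcs).
  move=> /(_ isT isT isT isT).
  rewrite separatesC !separates_lt//; last exact: lt_trans hsa.
  rewrite hcs hsa (ltNge s) cs (ltNge b) (ltW cb) !andbF.
  by rewrite (ltNge (h b)) (ltW hab) andbF.
pose c := h' (h s + 1).
have hsc : h s < h c by rewrite /c h'K; lra.
have /andP[ac cb] : a < c < b by apply: pre; right; lra.
have sc : s <= c.
  apply: ge_sup; first by exists u.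
  by move=> v vL; apply/ltW/LU => //; lra.
have := H b c s a.
rewrite (gt_eqF sb) (gt_eqF ab) (gt_eqF ac) -I (gt_eqF hsc).
move=> /(_ isT isT isT isT).
rewrite [in RHS]separatesC !separates_lt//; last exact: lt_trans hsc.
rewrite hbs hsc (ltNge c s) sc (ltNge c a) (ltW ac) /=.
by rewrite (ltNge (h b)) (ltW hab).
Qed.

Lemma preserves_betweenness h h' : cancel h h' -> cancel h' h ->
    preserves_separation h ->
  forall a b c, Num.min a b < c < Num.max a b ->
    Num.min (h a) (h b) < h c < Num.max (h a) (h b).
Proof.
move=> hK h'K H.
have lt a b c : a < c < b -> Num.min (h a) (h b) < h c < Num.max (h a) (h b).
  move=> acb; have [hab|hba|/(can_inj hK) e] := ltgtP (h a) (h b).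
  - exact: (preserves_betweenness_lt hK h'K).
  (* When [h] reverses [a] and [b], reflect: [-%R \o h] preserves separation too. *)
  - have NK : cancel (-%R \o h) (h' \o -%R) by move=> x /=; rewrite opprK hK.
    have N'K : cancel (h' \o -%R) (-%R \o h) by move=> x /=; rewrite h'K opprK.
    have HN : preserves_separation (-%R \o h).
      by move=> ? ? ? ? *; rewrite /= separatesN H.
    have := preserves_betweenness_lt NK N'K HN acb; rewrite /= !ltrN2.
    by rewrite andbC; exact.
  - by move: acb; rewrite e => /andP[x y]; have := lt_trans x y; rewrite ltxx.
move=> a b c; have [ab|ba|->] := ltgtP a b; first exact: lt.
  by rewrite minC maxC; exact: lt.
by move=> /andP[x y]; have := lt_trans x y; rewrite ltxx.
Qed.

(** Betweenness for [h'] makes the preimages of [h x - e] and [h x + e] enclose [x]; betweenness for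
    [h] sends the interval between them back into the [e]-ball. *)
Lemma preserves_separation_continuous h h' : cancel h h' -> cancel h' h ->
  preserves_separation h -> continuous h.
Proof.
move=> hK h'K H x; apply/cvgrPdist_lt => /= e e0.
have H' := preserves_separation_can hK h'K H.
have xuv : Num.min (h x - e) (h x + e) < h x < Num.max (h x - e) (h x + e).
  by have := ltP (h x - e) (h x + e) => -[]; lra.
have := preserves_betweenness h'K hK H' xuv; rewrite hK => xI.
have : x \in `](Num.min (h' (h x - e)) (h' (h x + e))),
            (Num.max (h' (h x - e)) (h' (h x + e)))[ by rewrite in_itv.
move=> /near_in_itvoo; apply: filterS => z; rewrite in_itv/= => zI.
have := preserves_betweenness hK h'K H zI; rewrite !h'K ltr_norml.
have [] := ltP (h x - e) (h x + e); lra.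
Qed.

Lemma preserves_separation_homeo h h' : cancel h h' -> cancel h' h ->
  preserves_separation h -> homeo h'.
Proof.
move=> hK h'K H; have H' := preserves_separation_can hK h'K H.
exists h; split => //; split => //.
by split; [exact: preserves_separation_continuous h'K hK H'|
           exact: preserves_separation_continuous hK h'K H].
Qed.

End separation_preserving.

(** * Density of empirical measures *)

Section density.
Variable R : realType.
Implicit Types (mu nu : probability R R) (x p z : R).

(** Right continuity makes the infimum of the [x] with [p <= distfun mu x] attained. *)
Lemma quantile mu p : 0 < p < 1 ->
  exists q, forall x, (p <= distfun mu x) = (q <= x).
Proof.
move=> /andP[p0 p1]; pose S := [set x | p <= distfun mu x].
have hS : has_inf S.
  have p1' : 0 < 1 - p by rewrite subr_gt0.
  split.
    by have [b hb] := distfun_cvgy mu p1'; exists b; rewrite /S/=; lra.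
  have [a ha] := distfun_cvgNy mu p0; exists a => y; rewrite /S/= => yS.
  rewrite leNgt; apply/negP => /ltW /(distfun_nd mu); lra.
have infS : S (inf S).
  apply: distfun_right => t; rewrite -subr_gt0 => t0.
  have [u uS ut] := inf_adherent t0 hS.
  by apply: le_trans uS _; apply: distfun_nd; lra.
exists (inf S) => x; apply/idP/idP => [xS|].
  by apply: ge_inf => //; case: hS.
by move=> /(distfun_nd mu); exact: le_trans.
Qed.

(* The sum is z rounded to a nearest integer. *)
Lemma count_half_integers N z : 0 <= z <= N%:R ->
  `|\sum_(i < N) (i%:R + 1 / 2 <= z)%R%:R - z| <= 1 / 2.
Proof.
move=> /andP[z0 zN]; rewrite ler_norml.
have {}z0 n : \sum_(i < n) (i%:R + 1 / 2 <= z)%R%:R <= n%:R :> R /\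
    \sum_(i < n) (i%:R + 1 / 2 <= z)%R%:R <= z + 1 / 2.
  elim: n => [|n [IH1 IH2]]; first by rewrite big_ord0; split; lra.
  rewrite big_ord_recr/= -(natr1 n).
  by have [h|h] := leP (n%:R + 1 / 2) z; split; rewrite /=; lra.
(* Either every term so far counts, or the sum has already reached [z - 1/2]; at [n = N] both
   suffice because [z <= N]. *)
have lo n : n%:R <= \sum_(i < n) (i%:R + 1 / 2 <= z)%R%:R :> R \/
    z - 1 / 2 <= \sum_(i < n) (i%:R + 1 / 2 <= z)%R%:R.
  elim: n => [|n IH]; first by rewrite big_ord0; left.
  rewrite big_ord_recr/= -(natr1 n).
  have [h|h] := leP (n%:R + 1 / 2) z; rewrite /=.
    by left; case: IH; lra.
  by right; case: IH; lra.
by have [_ h2] := z0 N; case: (lo N) => h; apply/andP; split; lra.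
Qed.

(** Sampling the quantiles of levels [(i + 1/2) / N] turns [N] times the empirical distribution
    function into a rounding of [N * distfun mu x]. Each deviation is then at most [1 / (2 N)]. *)
Lemma empirical_dense mu (e : R) : 0 < e ->
  exists t n, dKu mu (empirical t n.+1) < e.
Proof.
move=> /invSn_lt[n ne]; pose N : R := n.+1%:R; have N0 : 0 < N by [].
have /choice[t tP] : forall i : nat, exists q, (i < n.+1)%N ->
    forall x, ((i%:R + 1 / 2) / N <= distfun mu x) = (q <= x).
  (* Indices beyond the sample get the dummy value 0. *)
  move=> i; have [iN|iN] := ltnP i n.+1; last by exists 0.
  have [|q qP] := @quantile mu ((i%:R + 1 / 2) / N); last by exists q.
  have i0 : 0 <= i%:R :> R by [].
  have iN1 : i%:R + 1 <= N by rewrite natr1 ler_nat.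
  by rewrite divr_gt0 ?ltr_pdivrMr//; lra.
exists t, n; apply: le_lt_trans ne.
have close x : `|distfun (empirical t n.+1) x - distfun mu x| <= 1 / 2 / N.
  rewrite ler_pdivlMr// -[X in _ * X](gtr0_norm N0) -normrM mulrBl.
  rewrite [in X in X * N]distfunE pr_empirical divfK ?gt_eqF//.
  rewrite (eq_bigr (fun i : 'I_n.+1 =>
      (i%:R + 1 / 2 <= distfun mu x * N)%R%:R)); last first.
    move=> i _; rewrite -ler_pdivrMr// tP//; congr (nat_of_bool _)%:R.
    by apply/idP/idP; rewrite inE/= in_itv.
  apply: count_half_integers; rewrite mulr_ge0 ?distfun_ge0 ?(ltW N0)//=.
  by rewrite -/N -[leRHS]mul1r ler_pM2r// distfun_le1.
rewrite dKuE (_ : _^-1 = 1 / 2 / N + 1 / 2 / N); last first.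
  by rewrite -mulrDl -splitr div1r.
by apply: lerD; apply: dev_le => x; have := close x;
  rewrite ler_norml; move: (1 / 2 / N) => c; lra.
Qed.

End density.

(** * Composition of measures with homeomorphisms *)

Section homeomorphisms.
Variable R : realType.
Implicit Types (mu nu : probability R R) (g h : R -> R) (A B : set R).

Lemma image_can g h A : cancel g h -> cancel h g -> g @` A = h @^-1` A.
Proof.
move=> gK hK; apply/seteqP; split => [_ [x xA <-]/=|x xA]; first by rewrite gK.
by exists (h x); rewrite ?hK.
Qed.

Lemma continuous_measurable_preimage h A : continuous h -> measurable A ->
  measurable (h @^-1` A).
Proof.
move=> hc mA; rewrite -[X in measurable X]setTI.
exact: (continuous_measurable_fun hc).
Qed.

Lemma homeo_mono g : homeo g ->
  {mono g : x y / x <= y} \/ {mono g : x y /~ x <= y}.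
Proof.
move=> [h [gK [hK [gc hc]]]].
have [|||] := @itv_continuous_inj_mono R g `]-oo, +oo[.
- by apply: continuous_subspaceT.
- by move=> x y _ _ /(can_inj gK).
- move=> H; left; apply: le_mono => x y; apply: H; by rewrite in_itv.
- move=> H; right; apply: le_nmono => x y; apply: H; by rewrite in_itv.
Qed.

(** Images under [g] are preimages under its inverse [h], so [comp_homeo mu g] is the distribution
    of [h] under [mu]. *)
Lemma homeo_pushforward mu g : homeo g -> exists nu, meq nu (comp_homeo mu g).
Proof.
move=> [h [gK [hK [gc hc]]]].
have mh : measurable_fun setT h by exact: continuous_measurable_fun.
pose X : {mfun R >-> R} := HB.pack h (isMeasurableFun.Build _ _ _ _ h mh).
by exists (distribution mu X) => A mA; rewrite /comp_homeo (image_can _ gK hK).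
Qed.

Lemma comp_homeoV mu mu' g h : cancel g h -> cancel h g -> continuous g ->
  meq mu' (comp_homeo mu g) -> meq mu (comp_homeo mu' h).
Proof.
move=> gK hK gc H A mA; rewrite /comp_homeo (image_can _ hK gK) H.
  by rewrite /comp_homeo (image_can _ gK hK) -comp_preimage (_ : g \o h = id)//;
    apply/funext => x /=.
exact: continuous_measurable_preimage.
Qed.

(** An increasing [g] reparametrizes the distribution functions. A decreasing one sends closed rays
    to complements of open rays, which swaps the two suprema. *)
Lemma comp_homeo_dKu_le mu nu mu' nu' g : homeo g ->
    meq mu' (comp_homeo mu g) -> meq nu' (comp_homeo nu g) ->
  dKu mu' nu' <= dKu mu nu.
Proof.
move=> hg Hmu Hnu; have [h [gK [hK [gc hc]]]] := hg.
case: (homeo_mono hg) => mg.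
  have E m m' t : meq m' (comp_homeo m g) -> distfun m' t = distfun m (g t).
    move=> H; rewrite !distfunE /pr H// /comp_homeo (image_can _ gK hK).
    congr (fine (m _)); apply/funext => x /=.
    by rewrite !in_itv/= -[x in RHS]hK mg.
  rewrite !dKuE; apply: lerD; apply: dev_le => t;
    rewrite (E _ _ _ Hmu) (E _ _ _ Hnu); exact: dev_ge.
have E m m' t : meq m' (comp_homeo m g) ->
    distfun m' t = 1 - pr m `]-oo, (g t)[.
  move=> H; rewrite distfunE -prC// /pr H// /comp_homeo (image_can _ gK hK).
  congr (fine (m _)); rewrite setCitvl; apply/funext => x /=.
  by rewrite !in_itv/= andbT -[x in RHS]hK mg.
rewrite (dKu_sym mu nu) !dKuE; apply: lerD; apply: dev_le => t;
  rewrite (E _ _ _ Hmu) (E _ _ _ Hnu).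
  have := dev_ge_left nu mu (g t); lra.
have := dev_ge_left mu nu (g t); lra.
Qed.

Lemma comp_homeo_dKu mu nu mu' nu' g : homeo g ->
    meq mu' (comp_homeo mu g) -> meq nu' (comp_homeo nu g) ->
  dKu mu' nu' = dKu mu nu.
Proof.
move=> hg Hmu Hnu; apply/eqP; rewrite eq_le (comp_homeo_dKu_le hg)//=.
have [h [gK [hK [gc hc]]]] := hg; have hh : homeo h by exists g.
by apply: (comp_homeo_dKu_le hh); exact: comp_homeoV.
Qed.

Lemma comp_homeo_empirical g h (t : nat -> R) n : cancel g h -> cancel h g ->
  continuous h ->
  meq (empirical (h \o t) n.+1) (comp_homeo (empirical t n.+1) g).
Proof.
move=> gK hK hc A mA; rewrite /comp_homeo (image_can _ gK hK).
rewrite (prE (empirical (h \o t) n.+1))// (prE (empirical t n.+1)); last first.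
  exact: continuous_measurable_preimage.
by rewrite !pr_empirical; congr (_ / _)%:E; apply: eq_bigr => i _.
Qed.

End homeomorphisms.

Theorem theorem1p3 (R : realType) :
  (forall phi : probability R R -> probability R R,
      surjP phi -> dKu_isometry phi ->
      exists g : R -> R, homeo g /\
        forall mu : probability R R, meq (phi mu) (comp_homeo mu g))
  /\
  (forall g : R -> R, homeo g ->
      (exists phi : probability R R -> probability R R,
          forall mu, meq (phi mu) (comp_homeo mu g)) /\
      (forall phi : probability R R -> probability R R,
          (forall mu, meq (phi mu) (comp_homeo mu g)) ->
          surjP phi /\ dKu_isometry phi)).
Proof.
split=> [phi sphi iphi|g hg]; last first.
  have /choice[psi psiP] := fun mu => homeo_pushforward mu hg.
  split; first by exists psi.
  move=> phi H; split=> [nu|mu nu]; last exact: (comp_homeo_dKu hg).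
  have [h [gK [hK [gc hc]]]] := hg; have hh : homeo h by exists g.
  have [mu hmu] := homeo_pushforward nu hh; exists mu => A mA.
  by rewrite H//; apply/esym/(comp_homeoV hK gK hc hmu).
(* Pushing forward by [h] is composing with its inverse, so the homeomorphism sought is [g], not
   [h]. *)
have [h [g [hK gK phih]]] := isometry_dirac sphi iphi.
have hg : homeo g.
  by apply: (preserves_separation_homeo hK gK) => a b c d;
    exact: (isometry_separates iphi hK gK phih).
exists g; split=> // mu; have [mu' hmu'] := homeo_pushforward mu hg.
have hc : continuous h.
  by case: hg => h' [gh' [h'g [_ h'c]]]; rewrite (_ : h = h')//;
    apply/funext => x; apply: (can_inj gK); rewrite hK h'g.
suff e : meq (phi mu) mu' by move=> A mA; rewrite e// hmu'.
apply/dKu_eq0/eqP; rewrite eq_le; apply/andP; split; last first.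
  by rewrite dKuE addr_ge0// dev_ge0.
apply/ler_addgt0Pr => e e0; rewrite add0r.
have e20 : 0 < e / 2 by rewrite divr_gt0.
(* [phi] and composition with [g] agree on this empirical measure and both preserve distances, so
   each contributes at most [e / 2]. *)
have [t [n d]] := empirical_dense mu e20.
apply: le_trans (dKu_triangle _ (phi (empirical t n.+1)) _) _.
rewrite iphi (eq_dKul _ (isometry_empirical iphi hK gK phih t n)).
rewrite (comp_homeo_dKu hg (comp_homeo_empirical t n gK hK hc) hmu').
rewrite (dKu_sym _ mu); lra.
Qed.
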